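(* Let $t\ge2$, $N=t+2$, and let $\lambda$ be a partition with at most $N$ parts, with $t$-quotient $(\lambda^{(0)},\dots,\lambda^{(t-1)})$. For a partition $\nu$ put $k(\nu)=\nu_1-\nu_2$. If exactly two residue classes $r_A<r_B$ modulo $t$ contain two elements of $\beta(\lambda)$ and all others contain one (two-class profile), then $$d_1=t\bigl(k(\lambda^{(r_A)})+1\bigr),\qquad d_2=t\bigl(k(\lambda^{(r_B)})+1\bigr),\qquad \tilde d_3=t\bigl(|\lambda^{(r_A)}|-|\lambda^{(r_B)}|\bigr)+2(r_A-r_B).$$ If exactly one residue class $r_A$ contains three elements of $\beta(\lambda)$ and all others contain one (size-three profile), then $\lambda^{(r_A)}$ has three parts (zeros allowed) and $$d_1=t\bigl(\lambda^{(r_A)}_1-\lambda^{(r_A)}_2+1\bigr),\qquad d_2=t\bigl(\lambda^{(r_A)}_2-\lambda^{(r_A)}_3+1\bigr),\qquad \tilde d_3=d_1+d_2.$$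
   Context: For $\lambda=(\lambda_1\ge\dots\ge\lambda_N\ge0)$ let $\beta_j=\lambda_j+N-j$ and $\beta(\lambda)=\{\beta_1>\dots>\beta_N\}$. The $t$-quotient is computed from this beta set with $N$ elements: if the elements of $\beta(\lambda)$ congruent to $i$ modulo $t$ are $t\tilde a_1+i>t\tilde a_2+i>\dots>t\tilde a_{n}+i$, then $\lambda^{(i)}=(\tilde a_1-n+1,\tilde a_2-n+2,\dots,\tilde a_n)$. In the two-class profile $A=\{a_1>a_2\}$ and $B=\{b_1>b_2\}$ are the elements of $\beta(\lambda)$ in classes $r_A$ and $r_B$; in the size-three profile, with class $\{p>q>r\}$, $A=\{a_1>a_2\}=\{p,q\}$ and $B=\{b_1>b_2\}=\{q,r\}$. In both cases $d_1=a_1-a_2$, $d_2=b_1-b_2$, $\tilde d_3=a_1+a_2-b_1-b_2$. *)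

(* Defs.v *)
From HB Require Import structures.
From mathcomp Require Import all_boot all_order all_algebra.
From mathcomp Require Import zify.

Set Implicit Arguments.
Unset Strict Implicit.
Unset Printing Implicit Defensive.

Import Order.TTheory GRing.Theory Num.Theory.

(* s_j with indices starting at 1, padded with zeros. *)
Definition item (s : seq nat) (j : nat) : nat := nth 0 s j.-1.

(* Trailing zeros are allowed, so a partition with at most N parts is a
   weakly decreasing sequence of size at most N. *)
Definition is_partition (nu : seq nat) : bool := sorted geq nu.

Definition kdiff (nu : seq nat) : int := ((item nu 1)%:Z - (item nu 2)%:Z)%R.

(* The beta set, listed in strictly decreasing order (see [beta_sorted]). *)
Definition beta (N : nat) (la : seq nat) : seq nat :=
  [seq item la j + N - j | j <- iota 1 N].

Definition beta_class (t N : nat) (la : seq nat) (i : nat) : seq nat :=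
  [seq x <- beta N la | x %% t == i].

(* The j-th part is a~_j - n + j, where a~_j = (x_j - i) / t = x_j %/ t for
   the j-th largest element x_j of the class; the subtraction never truncates
   (see [item_tquotient]). *)
Definition tquotient (t N : nat) (la : seq nat) (i : nat) : seq nat :=
  let s := beta_class t N la i in
  let n := size s in
  [seq item s j %/ t + j - n | j <- iota 1 n].

Definition two_class_profile (t N : nat) (la : seq nat) (rA rB : nat) : Prop :=
  [/\ rA < rB, rB < t,
      size (beta_class t N la rA) = 2, size (beta_class t N la rB) = 2
    & forall i, i < t -> i <> rA -> i <> rB -> size (beta_class t N la i) = 1].

Definition size_three_profile (t N : nat) (la : seq nat) (rA : nat) : Prop :=
  [/\ rA < t, size (beta_class t N la rA) = 3
    & forall i, i < t -> i <> rA -> size (beta_class t N la i) = 1].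

(* For A = {a_1 > a_2} and B = {b_1 > b_2} listed decreasingly. *)
Definition d1 (A B : seq nat) : int := ((item A 1)%:Z - (item A 2)%:Z)%R.
Definition d2 (A B : seq nat) : int := ((item B 1)%:Z - (item B 2)%:Z)%R.
Definition d3tilde (A B : seq nat) : int :=
  ((item A 1)%:Z + (item A 2)%:Z - (item B 1)%:Z - (item B 2)%:Z)%R.

Lemma geq_trans : transitive geq.
Proof. by move=> y x z /= yx zy; apply: leq_trans zy yx. Qed.

Lemma gtn_trans : transitive gtn.
Proof. by move=> y x z /= yx zy; apply: ltn_trans zy yx. Qed.

Lemma item_mono nu i j : is_partition nu -> 0 < i -> i <= j ->
  item nu j <= item nu i.
Proof.
move=> nuP i0 ij; rewrite /item.
have [lej|ltj] := leqP (size nu) j.-1; first by rewrite nth_default.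
apply: (sorted_leq_nth geq_trans (leqnn : reflexive geq) 0 nuP);
  rewrite ?inE; lia.
Qed.

Lemma beta_sorted N la : is_partition la -> sorted gtn (beta N la).
Proof.
move=> laP; apply/(sortedP 0) => i; rewrite size_map size_iota => iN.
rewrite /beta !(nth_map 0) ?size_iota ?nth_iota //=; try lia.
have := @item_mono la (1 + i) (1 + i.+1) laP isT; lia.
Qed.

Lemma beta_class_sorted t N la i : is_partition la ->
  sorted gtn (beta_class t N la i).
Proof. by move=> laP; apply: sorted_filter (beta_sorted N laP); exact: gtn_trans. Qed.

(* Consecutive elements of one residue class differ by at least t. *)
Lemma item_beta_class_step t N la i j : 0 < t -> is_partition la ->
  0 < j < size (beta_class t N la i) ->
  item (beta_class t N la i) j.+1 %/ t < item (beta_class t N la i) j %/ t.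
Proof.
move=> t0 laP /andP[j0 js]; set s := beta_class _ _ _ _ in js *.
have inC k : k < size s -> nth 0 s k %% t = i.
  by move=> ks; have := mem_nth 0 ks; rewrite mem_filter => /andP[/eqP].
have /(sortedP 0) /(_ j.-1) := beta_class_sorted t N i laP.
rewrite -/s (prednK j0) => /(_ js) /= lt; rewrite /item /=.
have := inC j js; have := inC j.-1 (leq_ltn_trans (leq_pred j) js).
move=> e1 e2; move: lt.
rewrite [X in X < _](divn_eq _ t) [X in _ < X](divn_eq _ t) e1 e2.
by rewrite ltn_add2r ltn_pmul2r.
Qed.

Lemma item_tquotient t N la i j : 0 < t -> is_partition la ->
  0 < j <= size (beta_class t N la i) ->
  ((item (tquotient t N la i) j)%:Z =
     (item (beta_class t N la i) j %/ t)%N%:Z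
       - (size (beta_class t N la i))%:Z + j%:Z)%R.
Proof.
move=> t0 laP /andP[j0 js].
have E : item (tquotient t N la i) j = item (beta_class t N la i) j %/ t + j
    - size (beta_class t N la i).
  rewrite {1}/item /tquotient (nth_map 0) ?size_iota ?nth_iota; lia.
rewrite {}E; set s := beta_class _ _ _ _ in js *.
have main : size s <= item s j %/ t + j; last by lia.
have [k] := ubnP (size s - j); elim: k j j0 js => // k IH j j0 js lek.
have [le|lt] := leqP (size s) j; first exact: leq_trans le (leq_addl _ _).
have := @item_beta_class_step t N la i j t0 laP.
rewrite -/s j0 lt => /(_ isT).
by have := IH j.+1 isT lt; move: (_ %/ _) (_ %/ _) => x y; lia.
Qed.

Lemma tquotient_partition t N la i : 0 < t -> is_partition la ->
  is_partition (tquotient t N la i).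
Proof.
move=> t0 laP; apply/(sortedP 0) => j; rewrite size_map size_iota => js.
have := @item_beta_class_step t N la i j.+1 t0 laP js.
rewrite /tquotient /= !(nth_map 0) ?size_iota ?nth_iota; lia.
Qed.

(* Main.v *)
Require Import Defs.
From HB Require Import structures.
From mathcomp Require Import all_boot all_order all_algebra.
From mathcomp Require Import zify ring.

Set Implicit Arguments.
Unset Strict Implicit.
Unset Printing Implicit Defensive.

Import Order.TTheory GRing.Theory Num.Theory.
Local Open Scope ring_scope.

(** Both profiles reduce to one inversion formula, [item_beta_class]: in a class [i] with [n]
    elements, the [j]-th largest element is $t(\lambda^{(i)}_j+n-j)+i$. Differences within a class
    cancel the residue, and the shift $n-j$ contributes the $+1$. For $n=2$ the two elements sum to
    $t(|\lambda^{(i)}|+1)+2i$, so comparing two such classes leaves the size difference and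
    $2(r_A-r_B)$. *)

Lemma size_tquotient t N la i :
  size (tquotient t N la i) = size (beta_class t N la i).
Proof. by rewrite size_map size_iota. Qed.

(** Euclidean division by [t]: the remainder is [i] by membership in the class, and [item_tquotient]
    gives the quotient. Working in [int] keeps the shift free of truncation. *)
Lemma item_beta_class t N la i j : (0 < t)%N -> is_partition la ->
  (0 < j <= size (beta_class t N la i))%N ->
  (item (beta_class t N la i) j)%:Z =
    t%:Z * ((item (tquotient t N la i) j)%:Z
              + (size (beta_class t N la i))%:Z - j%:Z) + i%:Z.
Proof.
move=> t0 laP jP; rewrite item_tquotient //.
have xi : (item (beta_class t N la i) j %% t = i)%N.
  have /(mem_nth 0) : (j.-1 < size (beta_class t N la i))%N by lia.
  by rewrite mem_filter => /andP[/eqP].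
rewrite [in LHS](divn_eq (item _ j)%N t) xi PoszD PoszM; ring.
Qed.

Lemma sumn_size2 s : size s = 2%N -> sumn s = (item s 1 + item s 2)%N.
Proof. by case: s => [|x [|y []]] //= _; rewrite addn0. Qed.

Theorem proposition3p4 (t N : nat) (la : seq nat)
    (ht : (2 <= t)%N) (hN : N = (t + 2)%N)
    (hla : is_partition la) (hsize : (size la <= N)%N) :
  (forall rA rB : nat, two_class_profile t N la rA rB ->
     let A := beta_class t N la rA in
     let B := beta_class t N la rB in
     let laA := tquotient t N la rA in
     let laB := tquotient t N la rB in
     [/\ d1 A B = t%:Z * (kdiff laA + 1),
         d2 A B = t%:Z * (kdiff laB + 1)
       & d3tilde A B = t%:Z * ((sumn laA)%:Z - (sumn laB)%:Z)
                         + 2 * (rA%:Z - rB%:Z)])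
  /\
  (forall rA : nat, size_three_profile t N la rA ->
     let p := item (beta_class t N la rA) 1 in
     let q := item (beta_class t N la rA) 2 in
     let r := item (beta_class t N la rA) 3 in
     let A := [:: p; q] in
     let B := [:: q; r] in
     let laA := tquotient t N la rA in
     [/\ is_partition laA, size laA = 3%N,
         d1 A B = t%:Z * ((item laA 1)%:Z - (item laA 2)%:Z + 1),
         d2 A B = t%:Z * ((item laA 2)%:Z - (item laA 3)%:Z + 1)
       & d3tilde A B = d1 A B + d2 A B]).
Proof.
have t0 : (0 < t)%N by apply: leq_trans ht.
split=> [rA rB [_ _ sA sB _] | rA [_ sA _]] /=.
  have eA j := @item_beta_class t N la rA j t0 hla; rewrite sA in eA.
  have eB j := @item_beta_class t N la rB j t0 hla; rewrite sB in eB.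
  (* Each quotient has exactly two entries, so its size is the sum of [item] 1 and [item] 2. *)
  rewrite !sumn_size2 ?size_tquotient // !PoszD /d1 /d2 /d3tilde /kdiff.
  by rewrite !eA ?eB //; split; ring.
have eA j := @item_beta_class t N la rA j t0 hla; rewrite sA in eA.
rewrite tquotient_partition // size_tquotient sA /d1 /d2 /d3tilde /=.
(* Here [n = 3]; the shared middle element [q] cancels, so $\tilde d_3=p-r=(p-q)+(q-r)$. *)
by rewrite !eA //; split=> //; ring.
Qed.
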